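(* Let $G$ be a finitely generated group which is transport amenable. Then for every $p \in (1,\infty)$ the degree one reduced $\ell^p$-cohomology of $G$ vanishes, i.e. $\overline{\ell^p H}^1(\mathrm{Cay}(G,S)) = \{0\}$ for every finite symmetric generating set $S$ of $G$.
   Context: For a finite symmetric generating set $S$ of $G$, the Cayley graph $\Gamma=\mathrm{Cay}(G,S)$ has vertex set $G$ and edge set $E=\{(\gamma,\gamma') : \exists s\in S,\ s^{-1}\gamma=\gamma'\}$; $d_\Gamma$ is its graph distance. Functions take values in $\mathbb{K}=\mathbb{R}$ or $\mathbb{C}$. The gradient of $g:G\to\mathbb{K}$ is $\nabla g(\gamma,\gamma')=g(\gamma')-g(\gamma)$. The space of $p$-Dirichlet functions is $D^p(\Gamma)=\{f:G\to\mathbb{K} : \nabla f\in \ell^p(E)\}$ with norm $\|f\|_{D^p}^p=\|\nabla f\|_{\ell^p(E)}^p+|f(e)|^p$. The degree one reduced $\ell^p$-cohomology is $\overline{\ell^p H}^1(\Gamma)=D^p(\Gamma)/\overline{\ell^p(G)+\mathbb{K}}^{D^p}$ (closure in the $D^p$-norm, $\mathbb{K}$ denoting constant functions); it does not depend on the choice of $S$ up to isomorphism. The left and right regular actions are $(\lambda_\gamma f)(x)=f(\gamma^{-1}x)$ and $(\rho_\gamma f)(x)=f(x\gamma)$. For a function $\xi$ on $G$ set $\xi^\vee(x)=\xi(x^{-1})$ (so $\rho_s\xi^\vee=(\lambda_s\xi)^\vee$). A sequence of finitely supported probability measures $\xi_n$ on $G$ converges to a left-invariant mean if $\|\lambda_\gamma\xi_n-\xi_n\|_{\ell^1(G)}\to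 0$ for every $\gamma\in G$. For finitely supported probability measures $\xi,\phi$ on $G$, the transport cost is $\mathrm{trc}(\xi,\phi)=\inf_{m\in M(\xi,\phi)}\int_{G\times G} d_\Gamma(x,y)\,dm(x,y)$, where $M(\xi,\phi)$ is the set of finitely supported measures on $G\times G$ with marginals $\xi$ and $\phi$. The group $G$ is called transport amenable if there exist a finite (symmetric) generating set $S$, a constant $K>0$ and a sequence of finitely supported probability measures $\xi_n$ converging to a left-invariant mean such that for all $s\in S$ and all $n$, $\mathrm{trc}(\rho_s\xi_n^\vee,\xi_n^\vee)\le K$ (distance taken in $\mathrm{Cay}(G,S)$). *)

(* Defs.v *)
From HB Require Import structures.
From mathcomp Require Import all_boot all_order all_algebra.
From mathcomp Require Import all_classical all_reals all_analysis.
From mathcomp Require Import complex.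

Set Implicit Arguments.
Unset Strict Implicit.
Unset Printing Implicit Defensive.

Import Order.TTheory GRing.Theory Num.Theory.
Local Open Scope classical_set_scope.
Local Open Scope ring_scope.

Section CayleyDefs.
Variables (R : realType) (G : groupType).

Definition symmetric_gen (S : seq G) : Prop :=
  forall s, s \in S -> (s^-1)%g \in S.

Definition generating (S : seq G) : Prop :=
  forall g : G, exists l : seq G,
    all (fun s => s \in S) l /\ g = foldr (fun s acc => (s * acc)%g) 1%g l.

Definition cay_edges (S : seq G) : set (G * G) :=
  [set e | exists2 s, s \in S & ((s^-1) * e.1)%g = e.2].

(** Graph distance in Cay(G,S) (+oo if unreachable). *)
Definition cay_dist (S : seq G) (x y : G) : \bar R :=
  ereal_inf [set (n%:R)%:E | n in
    [set n : nat | exists l : seq G, [/\ size l = n, all (fun s => s \in S) l &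
        y = foldr (fun s acc => ((s^-1) * acc)%g) x l]]].

Section Valued.
(** Functions take values in K (= R or C), with absolute value nrm : K -> R. *)
Variables (K : zmodType) (nrm : K -> R).

Definition grad (f : G -> K) (e : G * G) : K := f e.2 - f e.1.

Definition grad_pnorm_p (S : seq G) (p : R) (f : G -> K) : \bar R :=
  (\esum_(e in cay_edges S) ((nrm (grad f e)) `^ p)%:E)%E.

Definition Dirichlet (S : seq G) (p : R) (f : G -> K) : Prop :=
  (grad_pnorm_p S p f < +oo)%E.

Definition Dnorm_p (S : seq G) (p : R) (f : G -> K) : \bar R :=
  (grad_pnorm_p S p f + ((nrm (f 1%g)) `^ p)%:E)%E.

Definition lp (p : R) (g : G -> K) : Prop :=
  (\esum_(x in [set: G]) ((nrm (g x)) `^ p)%:E < +oo)%E.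

Definition in_closure_lp_const (S : seq G) (p : R) (f : G -> K) : Prop :=
  forall eps : R, 0 < eps ->
    exists (g : G -> K) (c : K), lp p g /\
      (Dnorm_p S p (fun x => (f x - (g x + c))%R) < (eps `^ p)%:E)%E.

(** The reduced l^p cohomology D^p / closure(l^p + K) is trivial. *)
Definition reduced_lpH1_vanishes (S : seq G) (p : R) : Prop :=
  forall f : G -> K, Dirichlet S p f -> in_closure_lp_const S p f.
End Valued.

Definition fs_prob (xi : G -> R) : Prop :=
  [/\ forall x, 0 <= xi x, finite_set [set x | xi x != 0] &
      (\esum_(x in [set: G]) (xi x)%:E = 1)%E].

Definition lreg (g : G) (xi : G -> R) : G -> R := fun x => xi ((g^-1) * x)%g.
Definition rreg (g : G) (xi : G -> R) : G -> R := fun x => xi (x * g)%g.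
Definition check (xi : G -> R) : G -> R := fun x => xi (x^-1)%g.

Definition l1_norm (a : G -> R) : \bar R := (\esum_(x in [set: G]) (`|a x|)%:E)%E.

Definition cvg_left_inv_mean (xi : nat -> G -> R) : Prop :=
  forall g : G,
    (fun n => l1_norm (fun x => lreg g (xi n) x - xi n x)) @ \oo --> (0 : \bar R).

Definition coupling (xi phi : G -> R) (m : G * G -> R) : Prop :=
  [/\ forall e, 0 <= m e, finite_set [set e | m e != 0],
      forall x, (\esum_(y in [set: G]) (m (x, y))%:E = (xi x)%:E)%E &
      forall y, (\esum_(x in [set: G]) (m (x, y))%:E = (phi y)%:E)%E].

Definition trc (S : seq G) (xi phi : G -> R) : \bar R :=
  ereal_inf [set c | exists m : G * G -> R, coupling xi phi m /\
     c = (\esum_(e in [set: G * G]) (cay_dist S e.1 e.2 * (m e)%:E))%E].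

Definition transport_amenable : Prop :=
  exists (S : seq G) (C : R) (xi : nat -> G -> R),
    [/\ symmetric_gen S, generating S, 0 < C,
        (forall n, fs_prob (xi n)) /\ cvg_left_inv_mean xi &
        forall s n, s \in S -> (trc S (rreg s (check (xi n))) (check (xi n)) <= C%:E)%E].

End CayleyDefs.

(* Main.v *)
(* Write (lambda_y f)(x) = f(y^-1 x). The averages f_n = sum_y xi_n(y) lambda_y f
   of a p-Dirichlet function f differ from f by elements of l^p. A coupling of
   rho_s xi_n^v with xi_n^v writes lambda_s f_n - f_n as a combination of left
   translates of gradients of f, of total weight the transport cost; hence the
   gradients of the f_n are bounded in l^p. If f is bounded, they tend to 0
   pointwise because xi_n converges to an invariant mean, and since p > 1 some
   averages of them tend to 0 in norm (Banach-Saks). The same averages of the f_n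
   are in f + l^p, so f is a limit of elements of l^p + constants. Truncation
   reduces real f to bounded f, and complex f is treated by parts. *)
Require Import Defs.
From HB Require Import structures.
From mathcomp Require Import all_boot all_order all_algebra.
From mathcomp Require Import all_classical all_reals all_analysis.
From mathcomp Require Import complex ring lra.

Import Order.TTheory GRing.Theory Num.Theory.
Local Open Scope ring_scope.

Set Implicit Arguments.
Unset Strict Implicit.
Unset Printing Implicit Defensive.

(** * Sums of p-th powers *)

Lemma sum_mem_swap (R : nmodType) (I : eqType) (r q : seq I) (F : I -> R) :
  uniq r -> uniq q ->
  \sum_(i <- r | i \in q) F i = \sum_(i <- q | i \in r) F i.
Proof.
move=> r_uniq q_uniq; rewrite -big_filter -[RHS]big_filter; apply: perm_big.
apply: uniq_perm; rewrite ?filter_uniq// => i.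
by rewrite !mem_filter andbC.
Qed.

(** All estimates below are made on finite sums of reals; this equivalence carries them to the
    extended-real sums of the definitions. *)
Lemma esum_le_seqP (R : realType) (I : choiceType) (A : set I) (a : I -> R)
    (c : R) : (forall i, 0 <= a i) ->
  (\esum_(i in A) (a i)%:E <= c%:E)%E <->
  (forall r : seq I, uniq r -> (forall i, i \in r -> A i) ->
     \sum_(i <- r) a i <= c).
Proof.
move=> a0; split=> [le_c r r_uniq rA | le_c].
  rewrite -lee_fin; apply: le_trans le_c; apply: esum_ge.
  exists [set` r]%classic; first by split; [exact: finite_seq | exact: rA].
  by rewrite -fsbig_seq// sumEFin.
apply: ge_ereal_sup => _ [X [/finite_fsetP[Y ->] XA] <-].
by rewrite -fsbig_seq ?finmap.fset_uniq// sumEFin lee_fin le_c.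
Qed.

Lemma esum_finsupp (R : realType) (I : choiceType) (a : I -> R) (r : seq I) :
  (forall i, 0 <= a i) -> uniq r -> (forall i, a i != 0 -> i \in r) ->
  (\esum_(i in [set: I]) (a i)%:E)%E = (\sum_(i <- r) a i)%:E.
Proof.
move=> a0 r_uniq ar; apply/eqP; rewrite eq_le; apply/andP; split.
  apply/esum_le_seqP => // q q_uniq _.
  rewrite (bigID (mem r))/= [X in _ + X]big1 ?addr0 => [|i]; last first.
    by apply: contraNeq => /ar.
  rewrite sum_mem_swap// [leRHS](bigID (mem q))/= lerDl.
  by rewrite sumr_ge0.
rewrite -sumEFin fsbig_seq//; apply: esum_ge.
by exists [set` r]%classic.
Qed.

(** * Elementary inequalities for [x ^ p] *)

Section PowR.
Variables (R : realType) (p : R).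
Hypothesis p1 : 1 < p.

Let p0 : 0 < p. Proof. exact: lt_trans p1. Qed.

Lemma ler_powR2r (a b : R) : 0 <= a -> a <= b -> a `^ p <= b `^ p.
Proof.
move=> a0 ab; apply: ge0_ler_powR => //; first exact: ltW.
by rewrite nnegrE (le_trans a0).
Qed.

Lemma powR_convex (t a b : R) : 0 <= t <= 1 -> 0 <= a -> 0 <= b ->
  (t * a + (1 - t) * b) `^ p <= t * a `^ p + (1 - t) * b `^ p.
Proof.
move=> /andP[t0 t1] a0 b0.
have t01 : Itv.spec (@Itv.num_sem R) (Itv.Real `[0%Z, 1%Z]) t.
  by rewrite /Itv.num_sem/= ger0_real//= in_itv/= t0.
have := @convex_powR R p (ltW p1) (Itv.mk t01) a b.
rewrite !inE/= !in_itv/= !andbT => /(_ a0 b0).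
by rewrite !convRE.
Qed.

Lemma powR_addr (a b : R) : 0 <= a -> 0 <= b ->
  (a + b) `^ p <= 2 `^ p * (a `^ p + b `^ p).
Proof.
wlog ab : a b / a <= b => [th|] a0 b0.
  case: (leP a b) => [|/ltW] ab; first exact: th.
  by rewrite addrC [in leRHS]addrC th.
rewrite (@le_trans _ _ ((2 * b) `^ p))//.
  by apply: ler_powR2r; [rewrite addr_ge0 | lra].
by rewrite powRM// ler_pM2l ?powR_gt0// lerDr powR_ge0.
Qed.

Lemma powR_add_small (a t : R) : 0 <= a -> 0 <= t <= 1 ->
  (a + t) `^ p <= a `^ p + t * (a + 1) `^ p.
Proof.
move=> a0 t01; have -> : a + t = t * (a + 1) + (1 - t) * a by ring.
apply: le_trans (powR_convex t01 _ a0) _; first by rewrite addr_ge0.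
case/andP: t01 => t0 t1; rewrite addrC lerD2r ler_piMl ?powR_ge0//; lra.
Qed.

End PowR.

(** Encodes [||h||_p^p <= c] on [A] through finite partial sums: one family of real inequalities
    gives both summability and the bound. *)
Definition psum_le (R : realType) (I : choiceType) (p : R) (A : set I)
    (h : I -> R) (c : R) : Prop :=
  forall r : seq I, uniq r -> (forall i, i \in r -> A i) ->
    \sum_(i <- r) `|h i| `^ p <= c.

Section PSum.
Variables (R : realType) (I : choiceType) (p : R) (A : set I).
Hypothesis p1 : 1 < p.
Implicit Types (h : I -> R) (c d D : R).

Let p0 : 0 < p. Proof. exact: lt_trans p1. Qed.

Lemma psum_le_ge0 h c : psum_le p A h c -> 0 <= c.
Proof. by move=> /(_ [::]); rewrite big_nil; apply. Qed.

Lemma psum_le_dom h h' c : (forall i, A i -> `|h' i| <= `|h i|) ->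
  psum_le p A h c -> psum_le p A h' c.
Proof.
move=> hh hc r r_uniq rA; apply: le_trans (hc r r_uniq rA).
rewrite !big_seq; apply: ler_sum => i /rA Ai.
by rewrite ler_powR2r// hh.
Qed.

Lemma psum_le_eq h h' c : (forall i, A i -> h' i = h i) ->
  psum_le p A h c -> psum_le p A h' c.
Proof. by move=> hh; apply: psum_le_dom => i /hh ->. Qed.

Lemma psum_le_weak h c d : c <= d -> psum_le p A h c -> psum_le p A h d.
Proof. by move=> cd hc r *; apply: le_trans cd; exact: hc. Qed.

Lemma psum_le_crudeD h h' c c' :
  psum_le p A h c -> psum_le p A h' c' ->
  psum_le p A (fun i => h i + h' i) (2 `^ p * (c + c')).
Proof.
move=> hc hc' r r_uniq rA.
apply: (@le_trans _ _
  (2 `^ p * (\sum_(i <- r) `|h i| `^ p + \sum_(i <- r) `|h' i| `^ p))).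
  rewrite -big_split/= mulr_sumr; apply: ler_sum => i _.
  apply: le_trans (powR_addr _ _ _) => //.
  by rewrite ler_powR2r// ler_normD.
by rewrite ler_pM2l ?powR_gt0// lerD ?hc ?hc'.
Qed.

Lemma psum_leZ h c t : psum_le p A h c ->
  psum_le p A (fun i => t * h i) (`|t| `^ p * c).
Proof.
move=> hc r r_uniq rA.
under eq_bigr do rewrite normrM powRM//.
by rewrite -mulr_sumr ler_wpM2l ?powR_ge0// hc.
Qed.

Lemma psum_le0 h i : psum_le p A h 0 -> A i -> h i = 0.
Proof.
move=> h0 Ai; have /= := h0 [:: i] isT.
rewrite big_seq1 => /(_ _)/wrap[j|]; first by rewrite inE => /eqP->.
move=> hi; apply/eqP; rewrite -normr_eq0; apply/eqP.
by apply: (@powR_eq0_eq0 _ _ p); apply/eqP; rewrite eq_le hi powR_ge0.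
Qed.

(* Minkowski's inequality, in the form: [{h : ||h||_p <= c D^(1/p)}] adds up in
   [c]; it is the convexity of [x^p] at weights [c/(c+d)] and [d/(c+d)]. *)
Lemma psum_leD h h' c d D : 0 <= c -> 0 <= d ->
  psum_le p A h (c `^ p * D) -> psum_le p A h' (d `^ p * D) ->
  psum_le p A (fun i => h i + h' i) ((c + d) `^ p * D).
Proof.
rewrite le_eqVlt => /predU1P[<- d0|c0].
  rewrite powR0 ?gt_eqF// mul0r add0r => h0; apply: psum_le_eq => i Ai.
  by rewrite (psum_le0 h0 Ai) add0r.
rewrite le_eqVlt => /predU1P[<- hc|d0 hc hd].
  rewrite powR0 ?gt_eqF// mul0r addr0 => h0; apply: psum_le_eq hc => i Ai.
  by rewrite (psum_le0 h0 Ai) addr0.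
have cd0 : 0 < c + d by rewrite addr_gt0.
have cp0 := powR_gt0 p c0; have dp0 := powR_gt0 p d0.
have [t tE] : exists t, t = c / (c + d) by eexists.
have t01 : 0 <= t <= 1.
  by rewrite tE divr_ge0 ?(ltW c0) ?(ltW cd0)//= ler_pdivrMr// mul1r lerDl ltW.
have t'E : 1 - t = d / (c + d) by rewrite tE; field; rewrite gt_eqF.
move=> r r_uniq rA.
(* [|h i| + |h' i|] is [c + d] times the [t]-combination of [|h i| / c] and [|h' i| / d], and the
   [p]-th powers of each quotient sum to at most [D]. *)
have key i : `|h i + h' i| `^ p <= (c + d) `^ p *
    (t * (`|h i| `^ p / c `^ p) + (1 - t) * (`|h' i| `^ p / d `^ p)).
  apply: (@le_trans _ _ ((c + d) `^ p *
      (t * (`|h i| / c) + (1 - t) * (`|h' i| / d)) `^ p)).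
    have tge0 : 0 <= t * (`|h i| / c) + (1 - t) * (`|h' i| / d).
      case/andP: t01 => t0 t1.
      by rewrite addr_ge0 ?mulr_ge0 ?subr_ge0 ?invr_ge0 ?(ltW c0) ?(ltW d0).
    rewrite -powRM// ?(ltW cd0)//; apply: ler_powR2r => //.
    have -> : (c + d) * (t * (`|h i| / c) + (1 - t) * (`|h' i| / d)) =
      `|h i| + `|h' i| by rewrite t'E tE; field; rewrite !gt_eqF.
    exact: ler_normD.
  rewrite ler_pM2l ?powR_gt0//.
  have hi0 : 0 <= `|h i| / c by rewrite divr_ge0 ?(ltW c0).
  have hi0' : 0 <= `|h' i| / d by rewrite divr_ge0 ?(ltW d0).
  apply: le_trans (powR_convex p1 t01 hi0 hi0') _.
  have powRV x : 0 < x -> x^-1 `^ p = (x `^ p)^-1.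
    by move=> x0; rewrite -!powR_inv1 ?powR_ge0 ?ltW// powRAC.
  by rewrite !powRM ?invr_ge0 ?(ltW c0) ?(ltW d0)// !powRV.
apply: le_trans (ler_sum _ (fun i _ => key i)) _.
rewrite -mulr_sumr ler_pM2l ?powR_gt0// big_split/= -!mulr_sumr -!mulr_suml.
have {}hc := hc r r_uniq rA; have {}hd := hd r r_uniq rA.
rewrite (@le_trans _ _ (t * D + (1 - t) * D))//; last by rewrite -mulrDl subrKC mul1r.
case/andP: t01 => t0 t1.
by rewrite lerD// ler_wpM2l ?subr_ge0// ler_pdivrMr// mulrC.
Qed.

(** The common [D] lets the scale factors [c j] add. In the transport estimate [c j] is mass times
    walk length, and their sum is controlled by the cost. *)
Lemma psum_le_sum (J : Type) (r : seq J) (h : J -> I -> R) (c : J -> R) D :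
  0 <= D -> (forall j, 0 <= c j) ->
  (forall j, psum_le p A (h j) (c j `^ p * D)) ->
  psum_le p A (fun i => \sum_(j <- r) h j i) ((\sum_(j <- r) c j) `^ p * D).
Proof.
move=> D0 c0 hc; elim: r => [|j r IH].
  apply: (@psum_le_eq (fun=> 0)) => [i _|q _ _]; first by rewrite big_nil.
  by rewrite big1 ?mulr_ge0 ?powR_ge0// => i _; rewrite normr0 powR0// gt_eqF.
rewrite big_cons.
apply: (@psum_le_eq (fun i => h j i + \sum_(j <- r) h j i)) => [i _|].
  by rewrite big_cons.
by apply: psum_leD => //; rewrite sumr_ge0.
Qed.

(** [F] nearly attains the supremum of the finite sums, so a finite set disjoint from [F] adds less
    than [e]. *)
Lemma psum_le_tail h c e : psum_le p A h c -> 0 < e ->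
  exists2 F : seq I, forall i, i \in F -> A i &
    psum_le p (fun i => A i /\ i \notin F) h e.
Proof.
move=> hc e0.
pose E : set R := fun x => exists r, [/\ uniq r, (forall i, i \in r -> A i) &
  x = \sum_(i <- r) `|h i| `^ p].
have supE : has_sup E.
  split; first by exists 0, [::]; split => //; rewrite big_nil.
  by exists c => _ [r [r_uniq rA ->]]; exact: hc.
have [_ [F [F_uniq FA ->]] Fsup] := sup_adherent e0 supE.
exists F => // r r_uniq rA.
have : \sum_(i <- F ++ r) `|h i| `^ p <= sup E.
  apply: sup_ubound; first by case: supE.
  exists (F ++ r); split=> [|i|//].
    rewrite cat_uniq F_uniq r_uniq andbT/=.
    by apply/hasPn => i /rA[].
  by rewrite mem_cat => /orP[/FA|/rA[]].
rewrite big_cat/=; lra.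
Qed.

End PSum.

(** * A Banach-Saks property *)

Section BanachSaks.
Variables (R : realType) (I : choiceType) (p : R) (A : set I).
Hypothesis p1 : 1 < p.
Variables (u : nat -> I -> R) (M : R).
Hypothesis u_bounded : forall n, psum_le p A (u n) M.
Hypothesis u_cvg0 : forall i (e : R), A i -> 0 < e ->
  exists N, forall n, (N <= n)%N -> `|u n i| < e.

Let p0 : 0 < p. Proof. exact: lt_trans p1. Qed.

Lemma uniform_small (F : seq I) (e : R) : (forall i, i \in F -> A i) -> 0 < e ->
  exists n, forall i, i \in F -> `|u n i| < e.
Proof.
move=> FA e0.
suff [N hN] : exists N, forall i n, i \in F -> (N <= n)%N -> `|u n i| < e.
  by exists N => i iF; exact: hN.
elim: F FA => [_|i F IH FA]; first by exists 0%N.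
have [j jF|N1 hN1] := IH; first by apply: FA; rewrite inE jF orbT.
have [N2 hN2] := u_cvg0 (FA i (mem_head _ _)) e0.
exists (maxn N1 N2) => j n; rewrite inE geq_max => /predU1P[->|jF] /andP[n1 n2].
  exact: hN2.
exact: hN1.
Qed.

(* As [u n] tends to 0 pointwise, it is eventually small on a finite set
   carrying most of [v], so the [p]-th powers of the norms nearly add up. *)
Lemma psum_le_almost_disjoint (v : I -> R) (V : R) : psum_le p A v V ->
  exists n, psum_le p A (fun i => v i + u n i) (V + (2 `^ p * M + 1)).
Proof.
move=> vV.
have two_p : 0 < 2 `^ p :> R by rewrite powR_gt0.
(* The extra 1 in the bound is split in halves: off [F] the tail of [v] costs [2 ^ p] times this
   number, which is 1/2; on [F] the choice of [t] below keeps the increment at most 1/2. *)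
have e0 : 0 < (2 * 2 `^ p)^-1 :> R by rewrite invr_gt0 mulr_gt0.
have [F0 F0A vtail] := psum_le_tail vV e0.
pose F := undup F0.
have FA i : i \in F -> A i by rewrite mem_undup; exact: F0A.
pose B := \sum_(i <- F) (`|v i| + 1) `^ p.
have B0 : 0 <= B by apply: sumr_ge0 => i _; exact: powR_ge0.
pose t := (2 * (B + 1))^-1.
have t0 : 0 < t by rewrite invr_gt0; lra.
have t1 : t <= 1 by rewrite invf_le1; lra.
have tB : t * B <= 2^-1.
  by rewrite /t mulrC ler_pdivrMr; lra.
have [n n_small] := uniform_small FA t0.
exists n => r r_uniq rA; rewrite (bigID (mem F))/=.
have in_F : \sum_(i <- r | i \in F) `|v i + u n i| `^ p <= V + 2^-1.
  apply: (@le_trans _ _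
      (\sum_(i <- r | i \in F) (`|v i| `^ p + t * (`|v i| + 1) `^ p))).
    apply: ler_sum => i iF.
    apply: (@le_trans _ _ ((`|v i| + t) `^ p)).
      apply: ler_powR2r => //; apply: le_trans (ler_normD _ _) _.
      by rewrite lerD2l ltW// n_small.
    by apply: powR_add_small => //; rewrite (ltW t0).
  rewrite big_split/= lerD//.
    rewrite -big_filter; apply: vV; rewrite ?filter_uniq// => i.
    by rewrite mem_filter => /andP[_ /rA].
  rewrite -mulr_sumr; apply: le_trans tB; rewrite ler_pM2l//.
  rewrite sum_mem_swap ?undup_uniq// /B [leRHS](bigID (mem r))/=.
  by rewrite lerDl sumr_ge0// => i _; exact: powR_ge0.
have off_F : \sum_(i <- r | i \notin F) `|v i + u n i| `^ p <= 2^-1 + 2 `^ p * M.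
  have un' : psum_le p (fun i => A i /\ i \notin F0) (u n) M.
    by move=> q q_uniq qA; apply: u_bounded => // i /qA[].
  have := psum_le_crudeD p1 vtail un'.
  have -> : 2 `^ p * ((2 * 2 `^ p)^-1 + M) = 2^-1 + 2 `^ p * M.
    by field; rewrite gt_eqF.
  move=> /(_ [seq i <- r | i \notin F]); rewrite big_filter; apply.
    by rewrite filter_uniq.
  by move=> i; rewrite mem_filter mem_undup => /andP[-> /rA].
by apply: le_trans (lerD in_F off_F) _; lra.
Qed.

(** Choosing the indices one at a time costs at most [2 ^ p * M + 1] per step, so the growth is
    linear in [k], against the [k ^ p] of Minkowski's inequality. *)
Lemma psum_le_sums (k : nat) : exists ns : seq nat, size ns = k /\
  psum_le p A (fun i => \sum_(n <- ns) u n i) (k%:R * (2 `^ p * M + 1)).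
Proof.
elim: k => [|k [ns [sz IH]]].
  exists [::]; split=> // r _ _; rewrite mul0r big1// => i _.
  by rewrite big_nil normr0 powR0 ?gt_eqF.
have [n hn] := psum_le_almost_disjoint IH.
exists (n :: ns); split; first by rewrite /= sz.
apply: (psum_le_weak _ (psum_le_eq p1 _ hn)); first by rewrite -(natr1 k); lra.
by move=> i _; rewrite big_cons addrC.
Qed.

(* The sums of [k] terms have [p]-th power norm O(k), hence their averages
   O(k^(1-p)). *)
Lemma banach_saks (e : R) : 0 < e -> exists2 ns : seq nat, (0 < size ns)%N &
  psum_le p A (fun i => (size ns)%:R^-1 * \sum_(n <- ns) u n i) e.
Proof.
move=> e0; pose C := 2 `^ p * M + 1.
have M0 : 0 <= M := psum_le_ge0 (u_bounded 0).
have C0 : 0 < C by rewrite ltr_wpDl// mulr_ge0// powR_ge0.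
have q0 : 0 < p - 1 by rewrite subr_gt0.
(* The aim is [C / k ^ (p - 1) <= e], that is [k >= (C / e) ^ (1 / (p - 1))]. Using [k.+1] also
   keeps the list of indices nonempty. *)
pose b := (C / e) `^ (p - 1)^-1.
have [k kb] : exists k : nat, b <= k.+1%:R.
  exists (Num.truncn b); apply/ltW/truncnS_gt.
have k0 : 0 < k.+1%:R :> R by [].
have kn0 : k.+1%:R != 0 :> R by rewrite gt_eqF.
have [ns [sz hns]] := psum_le_sums k.+1.
exists ns; first by rewrite sz.
apply: (psum_le_weak _ (psum_leZ (size ns)%:R^-1 hns)).
rewrite sz -/C ger0_norm ?invr_ge0// mulrA.
have -> : k.+1%:R^-1 `^ p * k.+1%:R = (k.+1%:R `^ (p - 1))^-1 :> R.
  rewrite -!powR_inv1 ?powR_ge0 ?ltW// powRAC.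
  rewrite -[X in _ * X]powRr1 ?ltW// -!powRrM -powRD ?kn0 ?implybT//.
  by congr (_ `^ _); ring.
rewrite mulrC ler_pdivrMr ?powR_gt0// mulrC -ler_pdivrMr//.
have -> : C / e = b `^ (p - 1).
  by rewrite /b -powRrM mulVf ?gt_eqF// powRr1 ?divr_ge0 ?ltW.
by apply: ge0_ler_powR => //; rewrite ?ltW// nnegrE ?powR_ge0 ?ltW.
Qed.

End BanachSaks.

(** * Translations and changes of generating set *)

Section Translations.
Variables (R : realType) (G : groupType) (p : R).
Hypothesis p1 : 1 < p.
Implicit Types (S : seq G) (f : G -> R) (D : R).

Let p0 : 0 < p. Proof. exact: lt_trans p1. Qed.

(** This is [lambda_s f - f]: the gradient along the edges labelled [s], indexed by their origin. *)
Definition lgrad (s : G) f (x : G) : R := f (s^-1 * x)%g - f x.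

Definition walk (z : G) (l : seq G) : G :=
  foldr (fun s acc => (s^-1 * acc)%g) z l.

(** Take a word for [g z^-1] and invert its letters, since a step multiplies by the inverse of its
    letter. *)
Lemma walk_reach S z g : symmetric_gen S -> generating S ->
  exists l, all (fun s => s \in S) l /\ g = walk z l.
Proof.
move=> S_sym S_gen; have [l [lS gE]] := S_gen (g * z^-1)%g.
exists [seq (s^-1)%g | s <- l]; split.
  by rewrite all_map; apply: sub_all lS => s /=; exact: S_sym.
have -> : g = (g * z^-1 * z)%g by rewrite divgK.
rewrite gE /walk; elim: l {lS gE} => [|s l IH] /=; first by rewrite mul1g.
by rewrite invgK -mulgA IH.
Qed.

Lemma psum_le_inj (I J : choiceType) (A : set I) (B : set J) (e : I -> J)
    (h : J -> R) c : injective e -> (forall i, A i -> B (e i)) ->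
  psum_le p B h c -> psum_le p A (fun i => h (e i)) c.
Proof.
move=> e_inj AB hc r r_uniq rA.
have := hc [seq e i | i <- r]; rewrite big_map; apply; first by rewrite map_inj_uniq.
by move=> _ /mapP[i ir ->]; exact/AB/rA.
Qed.

Lemma psum_le_lgrad S f D s : s \in S ->
  psum_le p (cay_edges S) (grad f) D -> psum_le p setT (lgrad s f) D.
Proof.
move=> sS; apply: (@psum_le_inj _ _ _ _ (fun x => (x, (s^-1 * x)%g))).
  by move=> x y [].
by move=> x _; exists s.
Qed.

(** Each edge carries at least one label in [S], so the sum over edges is at most the sum over
    labels of the sums over origins. *)
Lemma psum_le_grad S f D :
  (forall s, s \in S -> psum_le p setT (lgrad s f) D) ->
  psum_le p (cay_edges S) (grad f) ((size S)%:R * D).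
Proof.
move=> fD r r_uniq rS.
apply: (@le_trans _ _ (\sum_(e <- r) \sum_(s <- S | (s^-1 * e.1)%g == e.2)
    `|grad f e| `^ p)).
  rewrite !big_seq; apply: ler_sum => e /rS [s sS es].
  rewrite (big_rem s)//= es eqxx lerDl sumr_ge0// => *; exact: powR_ge0.
rewrite (exchange_big_dep xpredT)//=.
rewrite -sum1_size natr_sum mulr_suml !big_seq; apply: ler_sum => s sS.
rewrite mul1r -big_filter.
apply: le_trans (fD s sS [seq e.1 | e <- r & (s^-1 * e.1)%g == e.2] _ _) => //.
  rewrite big_map !big_seq; apply: ler_sum => -[x y].
  by rewrite mem_filter/= => /andP[/eqP <- _].
rewrite map_inj_in_uniq ?filter_uniq// => -[x y] [x' y'].
by rewrite !mem_filter/= => /andP[/eqP <- _] /andP[/eqP <- _] ->.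
Qed.

(** Telescoping: each step is some [lgrad s f] composed with a left multiplication, which keeps the
    bound [D], and Minkowski's inequality adds up the [size l] steps. *)
Lemma psum_le_walk S f D z l :
  (forall s, s \in S -> psum_le p setT (lgrad s f) D) ->
  all (fun s => s \in S) l ->
  psum_le p setT (fun x => f (walk z l * x)%g - f (z * x)%g)
    ((size l)%:R `^ p * D).
Proof.
move=> fD; elim: l => [_|s l IH /= /andP[sS lS]].
  apply: (@psum_le_eq _ _ _ _ p1 (fun=> 0)) => [x _|r _ _]; first by rewrite subrr.
  by rewrite powR0 ?gt_eqF// mul0r big1// => i _; rewrite normr0 powR0 ?gt_eqF.
rewrite -natr1 addrC.
apply: (psum_le_eq p1 _ (psum_leD p1 ler01 (ler0n _ _) _ (IH lS))) => [x _|].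
  by rewrite -mulgA; exact: esym (subrKA _ _ _).
rewrite powR1 mul1r.
apply: (@psum_le_inj _ _ _ setT (fun x => (walk z l * x)%g) _ _ _ _ (fD s sS)) => //.
exact: mulgI.
Qed.

Lemma psum_le_translate S f D y : symmetric_gen S -> generating S ->
  psum_le p (cay_edges S) (grad f) D ->
  exists c, 0 <= c /\ psum_le p setT (fun x => f (y * x)%g - f x) (c `^ p * D).
Proof.
move=> S_sym S_gen fD; have [l [lS yE]] := walk_reach 1%g y S_sym S_gen.
exists (size l)%:R; split => //.
apply: (psum_le_eq p1 _ (psum_le_walk 1%g (fun s sS => psum_le_lgrad sS fD) lS)).
by move=> x _; rewrite -yE mul1g.
Qed.

(** Each [s^-1] with [s] in [S'] is a word in [S]. As [C] depends on [S] and [S'] alone, small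
    gradients stay small. *)
Lemma psum_le_grad_change S S' : symmetric_gen S -> generating S ->
  exists2 C, 0 < C & forall f D, psum_le p (cay_edges S) (grad f) D ->
    psum_le p (cay_edges S') (grad f) (C * D).
Proof.
move=> S_sym S_gen.
have [l hl] := choice (fun s : G => walk_reach 1%g (s^-1)%g S_sym S_gen).
pose k := (\sum_(s <- S') size (l s))%N.
(* [k] bounds all word lengths; the [+ 1] makes the constant positive in all cases. *)
exists ((size S')%:R * k%:R `^ p + 1) => [|f D fD].
  by rewrite ltr_wpDl// mulr_ge0// powR_ge0.
have D0 := psum_le_ge0 fD.
apply: (@psum_le_weak _ _ _ _ _ ((size S')%:R * (k%:R `^ p * D))).
  by rewrite mulrDl mul1r -mulrA lerDl.
apply: psum_le_grad => s sS'; have [lS sE] := hl s.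
apply: (psum_le_eq p1 _ (psum_le_weak _
  (psum_le_walk 1%g (fun s sS => psum_le_lgrad sS fD) lS))).
  by move=> x _; rewrite -sE mul1g.
rewrite ler_wpM2r// ler_powR2r// ler_nat /k (big_rem s)//=; exact: leq_addr.
Qed.

End Translations.

(** * Averages and transport *)

Lemma fsum_finsupp (R : pzRingType) (I : choiceType) (a b : I -> R) (r : seq I) :
  uniq r -> (forall i, a i != 0 -> i \in r) ->
  \sum_(i \in [set: I]) a i * b i = \sum_(i <- r) a i * b i.
Proof.
move=> r_uniq ar; rewrite -set_true -(bigfs _ r_uniq)// => i _ ir.
by have [->|/ar] := eqVneq (a i) 0; rewrite ?mul0r// (negPf ir).
Qed.

Lemma finsupp_seq (R : nmodType) (I : choiceType) (a : I -> R) :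
  finite_set [set i | a i != 0]%classic ->
  exists2 r : seq I, uniq r & forall i, a i != 0 -> i \in r.
Proof.
move=> /finite_seqP[r rE]; exists (undup r); first exact: undup_uniq.
move=> i ai; rewrite mem_undup.
by have /= <- := f_equal (fun A : set I => A i) rE.
Qed.

Section Averages.
Variables (R : realType) (G : groupType) (p : R).
Hypothesis p1 : 1 < p.
Implicit Types (S : seq G) (f : G -> R) (D : R) (eta xi : G -> R).

Lemma fs_prob_comp xi (g : G -> G) : bijective g -> fs_prob xi ->
  fs_prob (fun x => xi (g x)).
Proof.
move=> g_bij [xi0 xi_fin xi1]; split => [x|//|//].
- exact: xi0.
- apply: (@finite_preimage _ _ [set x | xi x != 0]%classic g) => //.
  by move=> x y _ _; exact: bij_inj.
- rewrite -(@reindex_esum _ _ _ setT setT g (fun x => (xi x)%:E))//.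
  by rewrite setTT_bijective.
Qed.

Lemma fs_prob_check xi : fs_prob xi -> fs_prob (Defs.check xi).
Proof. by apply: fs_prob_comp; exists (fun x : G => x^-1)%g; exact: invgK. Qed.

Lemma fs_prob_rreg s xi : fs_prob xi -> fs_prob (rreg s xi).
Proof.
by apply: fs_prob_comp; exists (fun x => x * s^-1)%g => x; rewrite ?mulgK ?divgK.
Qed.

Lemma fs_prob_sum1 xi (r : seq G) : fs_prob xi -> uniq r ->
  (forall x, xi x != 0 -> x \in r) -> \sum_(x <- r) xi x = 1.
Proof. by move=> [xi0 _ xi1] r_uniq xir; apply: EFin_inj; rewrite -esum_finsupp. Qed.

(** For [eta = xi^v] this is [sum_y xi(y) lambda_y f], by the substitution [z = y^-1]. *)
Definition lavg eta f (x : G) : R := \sum_(z \in [set: G]) eta z * f (z * x)%g.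

(** Substituting [z s] for [z] moves the left translation of the average onto the weights as
    [rho_s]; hence the role of transport from [rho_s eta] to [eta]. *)
Lemma lgrad_lavg s eta f x :
  lgrad s (lavg eta f) x = lavg (rreg s eta) f x - lavg eta f x.
Proof.
congr (_ - _); rewrite /lavg (reindex_fsbigT (fun z => z * s)%g).
  by apply: eq_fsbigr => z _; rewrite mulgA mulgK.
by exists (fun z => z * s^-1)%g => z; rewrite ?mulgK ?divgK.
Qed.

(** As [eta] has mass 1, the difference is the finite combination of the functions [f(z x) - f(x)]
    with weights [eta z], and each lies in l^p. *)
Lemma psum_le_lavg_sub S f D eta : symmetric_gen S -> generating S ->
  psum_le p (cay_edges S) (grad f) D -> fs_prob eta ->
  exists c, psum_le p setT (fun x => lavg eta f x - f x) c.
Proof.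
move=> S_sym S_gen fD eta_prob; have [eta0 eta_fin eta1] := eta_prob.
have [r r_uniq etar] := finsupp_seq eta_fin.
have [c hc] := choice (fun y => psum_le_translate p1 y S_sym S_gen fD).
exists ((\sum_(z <- r) eta z * c z) `^ p * D).
apply: (psum_le_eq p1 _ (@psum_le_sum _ _ _ _ p1 _ r
  (fun z x => eta z * (f (z * x)%g - f x)) (fun z => eta z * c z) D _ _ _)).
- move=> x _; under [RHS]eq_bigr do rewrite mulrBr.
  rewrite sumrB -mulr_suml (fs_prob_sum1 eta_prob)// mul1r.
  by rewrite /lavg (fsum_finsupp _ r_uniq etar).
- exact: psum_le_ge0 fD.
- by move=> z; rewrite mulr_ge0//; case: (hc z).
- move=> z; have [cz0 hz] := hc z.
  by have := psum_leZ (eta z) hz; rewrite ger0_norm// mulrA -powRM.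
Qed.

(** The gradient pairs [rho_s eta - eta], where [eta = xi^v], with the bounded values [f(z x)]. *)
Lemma lavg_bound s xi f (x : G) (B e : R) :
  fs_prob xi -> (forall y, `|f y| <= B) ->
  (l1_norm (fun y => (lreg s xi y - xi y)%R) < e%:E)%E ->
  `|lgrad s (lavg (Defs.check xi) f) x| <= B * e.
Proof.
move=> xi_prob fB.
have eta_prob := fs_prob_check xi_prob; set eta := Defs.check xi in eta_prob *.
have [_ eta_fin _] := eta_prob; have [_ eta'_fin _] := fs_prob_rreg s eta_prob.
have [r1 _ er1] := finsupp_seq eta_fin; have [r2 _ er2] := finsupp_seq eta'_fin.
pose r := undup (r1 ++ r2); have r_uniq : uniq r by exact: undup_uniq.
have er z : eta z != 0 -> z \in r by move=> /er1; rewrite mem_undup mem_cat => ->.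
have e'r z : rreg s eta z != 0 -> z \in r.
  by move=> /er2; rewrite mem_undup mem_cat orbC => ->.
(* Inversion carries [lambda_s xi - xi] to [rho_s eta - eta] and preserves the l^1 norm. *)
have -> : l1_norm (fun y => lreg s xi y - xi y) =
    (\sum_(z <- r) `|rreg s eta z - eta z|)%:E.
  rewrite /l1_norm (@reindex_esum _ _ _ setT setT (fun x : G => x^-1)%g);
    last by rewrite setTT_bijective; exists (fun x : G => x^-1)%g; exact: invgK.
  rewrite -esum_finsupp// => [|z].
    by apply: eq_esum => z _; rewrite /eta /rreg /Defs.check /lreg invgM.
  rewrite normr_eq0; apply: contraR => zr.
  have [->|/e'r] := eqVneq (rreg s eta z) 0; last by rewrite (negPf zr).
  by have [->|/er] := eqVneq (eta z) 0; [rewrite subrr|rewrite (negPf zr)].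
rewrite lte_fin lgrad_lavg /lavg => le_e.
rewrite (fsum_finsupp _ r_uniq e'r) (fsum_finsupp _ r_uniq er) -sumrB.
apply: le_trans (ler_norm_sum _ _ _) _.
have B0 : 0 <= B := le_trans (normr_ge0 _) (fB x).
apply: le_trans (ler_wpM2l B0 (ltW le_e)); rewrite mulr_sumr.
by apply: ler_sum => z _; rewrite -mulrBl normrM mulrC ler_wpM2r.
Qed.

(** Approximates the infimum within 1; against a coupling of mass 1 this slack costs 1 in all. The
    distance is finite because some walk exists. *)
Lemma cay_dist_walk S x y : symmetric_gen S -> generating S ->
  exists l, [/\ all (fun s => s \in S) l, y = walk x l &
    ((size l)%:R%:E <= cay_dist R S x y + 1)%E].
Proof.
move=> S_sym S_gen; have [l0 [l0S yE0]] := walk_reach x y S_sym S_gen.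
have dfin : cay_dist R S x y \is a fin_num.
  rewrite ge0_fin_numE; last first.
    apply: le_ereal_inf_tmp => _ [n _ <-]; by rewrite lee_fin.
  apply: (@le_lt_trans _ _ ((size l0)%:R)%:E); last exact: ltry.
  by apply: ge_ereal_inf; exists (size l0)%:R%:E => //; exists (size l0) => //; exists l0.
have [_ [n [l [<- lS yE]] <-] /ltW ?] := lb_ereal_inf_adherent ltr01 dfin.
by exists l.
Qed.

(** Change of variables: [w] is the image under [g] of the weights [m]. It serves for both
    projections of a coupling. *)
Lemma fsum_marginal (I : eqType) (m : I -> R) (r : seq I) (g : I -> G)
    (w phi : G -> R) : (forall x, \sum_(e <- r | g e == x) m e = w x) ->
  \sum_(x \in [set: G]) w x * phi x = \sum_(e <- r) m e * phi (g e).
Proof.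
move=> wE; pose q := undup [seq g e | e <- r].
rewrite (@fsum_finsupp _ _ _ _ q) ?undup_uniq// => [|x].
  transitivity (\sum_(x <- q) \sum_(e <- r | g e == x) m e * phi (g e)).
    by apply: eq_bigr => x _; rewrite -wE mulr_suml; apply: eq_bigr => e /eqP ->.
  rewrite (exchange_big_dep xpredT)//= !big_seq; apply: eq_bigr => e er.
  rewrite -big_filter (_ : [seq x <- q | g e == x] = [:: g e]) ?big_seq1//.
  rewrite (eq_filter (a2 := pred1 (g e))) => [|x]; last by rewrite /= eq_sym.
  by rewrite filter_pred1_uniq ?undup_uniq// mem_undup map_f.
apply: contraR => xq; rewrite -wE big_seq_cond big1// => e /andP[er /eqP gx].
by move: xq; rewrite mem_undup -gx map_f.
Qed.

Lemma coupling_sub (xi phi : G -> R) (m : G * G -> R) (r : seq (G * G)) f x :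
  coupling xi phi m -> uniq r -> (forall e, m e != 0 -> e \in r) ->
  lavg xi f x - lavg phi f x =
  \sum_(e <- r) m e * (f (e.1 * x)%g - f (e.2 * x)%g).
Proof.
move=> [m0 _ m1 m2] r_uniq mr.
rewrite /lavg (@fsum_marginal _ m r fst xi (fun z => f (z * x)%g)); last first.
  move=> y; apply: EFin_inj; rewrite -m1.
  rewrite (@esum_finsupp _ _ _ [seq e.2 | e <- r & e.1 == y])//.
  - by rewrite big_map big_filter; congr EFin; apply: eq_bigr => -[a b] /= /eqP ->.
  - rewrite map_inj_in_uniq ?filter_uniq// => -[a b] [a' b'].
    by rewrite !mem_filter/= => /andP[/eqP -> _] /andP[/eqP -> _] ->.
  - by move=> z /mr yz; apply/mapP; exists (y, z); rewrite ?mem_filter/= ?eqxx.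
rewrite (@fsum_marginal _ m r snd phi (fun z => f (z * x)%g)); last first.
  move=> y; apply: EFin_inj; rewrite -m2.
  rewrite (@esum_finsupp _ _ _ [seq e.1 | e <- r & e.2 == y])//.
  - by rewrite big_map big_filter; congr EFin; apply: eq_bigr => -[a b] /= /eqP ->.
  - rewrite map_inj_in_uniq ?filter_uniq// => -[a b] [a' b'].
    by rewrite !mem_filter/= => /andP[/eqP -> _] /andP[/eqP -> _] ->.
  - by move=> z /mr yz; apply/mapP; exists (z, y); rewrite ?mem_filter/= ?eqxx.
by rewrite -sumrB; apply: eq_bigr => e _; rewrite mulrBr.
Qed.

Lemma coupling_mass (xi phi : G -> R) (m : G * G -> R) (r : seq (G * G)) :
  fs_prob xi -> coupling xi phi m -> uniq r -> (forall e, m e != 0 -> e \in r) ->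
  \sum_(e <- r) m e = 1.
Proof.
move=> xi_prob [m0 m_fin m1 m2] r_uniq mr.
have [xi0 _ xi1] := xi_prob; apply: EFin_inj; rewrite -xi1.
rewrite -(esum_finsupp m0 r_uniq mr).
under [RHS]eq_esum do rewrite -m1.
rewrite (@esum_esum _ _ _ setT (fun=> setT) (fun x y => (m (x, y))%:E)); last first.
  by move=> *; rewrite lee_fin.
rewrite (_ : (setT `*`` _)%classic = setT); last by apply/seteqP; split.
by apply: eq_esum => -[].
Qed.

(* A coupling moves [z] to [z'] along a walk of left multiplications, so that
   [f (z x) - f (z' x)], as a function of [x], is a sum of [d(z, z')] left
   translates of gradients of [f]. *)
Lemma psum_le_lgrad_lavg S f D C s eta : symmetric_gen S -> generating S ->
  psum_le p (cay_edges S) (grad f) D -> fs_prob eta -> 0 < C ->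
  (trc S (rreg s eta) eta <= C%:E)%E ->
  psum_le p setT (lgrad s (lavg eta f)) ((C + 2) `^ p * D).
Proof.
move=> S_sym S_gen fD eta_prob C0 trcC.
have D0 := psum_le_ge0 fD.
(* A coupling of cost below [C + 1] is taken from the infimum; the second unit in [C + 2] is the
   slack in the walk lengths, weighted by total mass 1. *)
have /ereal_inf_lt[_ [m [m_coupl ->]] mC] : (trc S (rreg s eta) eta < (C + 1)%:E)%E.
  by apply: le_lt_trans trcC _; rewrite lte_fin ltrDl.
have [m0 m_fin _ _] := m_coupl.
have [r r_uniq mr] := finsupp_seq m_fin.
have [l hl] := choice (fun e : G * G => cay_dist_walk e.1 e.2 S_sym S_gen).
have m1 := coupling_mass (fs_prob_rreg s eta_prob) m_coupl r_uniq mr.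
pose k e := m e * (size (l e))%:R.
have k0 e : 0 <= k e by rewrite mulr_ge0.
have sum_k : \sum_(e <- r) k e <= C + 2.
  rewrite -lee_fin -sumEFin.
  apply: (@le_trans _ _
      (\sum_(e <- r) (cay_dist R S e.1 e.2 * (m e)%:E + (m e)%:E))%E).
    apply: lee_sum => e _; have [_ _ le_d] := hl e.
    rewrite /k mulrC EFinM -{3}[(m e)%:E]mul1e -ge0_muleDl//; last first.
      by apply: le_ereal_inf_tmp => _ [n _ <-]; rewrite lee_fin.
    by rewrite lee_wpmul2r// lee_fin.
  rewrite big_split/= sumEFin m1.
  have -> : C + 2 = (C + 1) + 1 by ring.
  rewrite EFinD leeD// (le_trans _ (ltW mC))//.
  rewrite fsbig_seq//; apply: esum_ge; exists [set` r]%classic => //.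
apply: (@psum_le_weak _ _ _ _ _ ((\sum_(e <- r) k e) `^ p * D)).
  by rewrite ler_wpM2r// ler_powR2r// sumr_ge0.
(* Walks lead from [e.1] to [e.2], opposite to the sign in [coupling_sub]; hence [- m e]. *)
apply: (psum_le_eq p1 _ (@psum_le_sum _ _ _ _ p1 _ r
  (fun e x => - m e * (f (e.2 * x)%g - f (e.1 * x)%g)) k D D0 k0 _)).
  move=> x _; rewrite lgrad_lavg (coupling_sub _ _ m_coupl r_uniq mr).
  by apply: eq_bigr => e _; rewrite mulNr -mulrN opprB.
move=> e; have [lS eE _] := hl e.
have := psum_leZ (- m e) (psum_le_walk p1 e.1 (fun s sS => psum_le_lgrad sS fD) lS).
by rewrite normrN ger0_norm// mulrA -powRM// -eE.
Qed.

End Averages.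

(** * Approximation *)

Section Truncation.
Variable R : realType.
Implicit Types k x y : R.

Definition clamp k y : R := Num.max (- k) (Num.min y k).

Lemma clamp_id k y : `|y| <= k -> clamp k y = y.
Proof. by rewrite ler_norml => /andP[ky yk]; rewrite /clamp min_l// max_r. Qed.

Lemma clamp_bounded k y : 0 <= k -> `|clamp k y| <= k.
Proof.
by move=> k0; rewrite ler_norml /clamp /Num.max /Num.min; do 2![case: ifP]; lra.
Qed.

Lemma clamp_lip k x y : 0 <= k -> `|clamp k y - clamp k x| <= `|y - x|.
Proof.
move=> k0; rewrite ler_norml /clamp !maxEle !minEle.
by case: (lerP x y) => xy; do ![case: ifP]; lra.
Qed.

Lemma clamp_rest_lip k x y : 0 <= k ->
  `|(y - clamp k y) - (x - clamp k x)| <= `|y - x|.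
Proof.
move=> k0; rewrite ler_norml /clamp !maxEle !minEle.
by case: (lerP x y) => xy; do ![case: ifP]; lra.
Qed.

End Truncation.

(** * Dirichlet functions modulo l^p, up to small gradient *)

Section Approximation.
Variables (R : realType) (G : groupType) (p : R).
Hypothesis p1 : 1 < p.
Implicit Types (S : seq G) (f h : G -> R) (B D e : R).

Let p0 : 0 < p. Proof. exact: lt_trans p1. Qed.

Lemma ex_psum_le_sum (I : choiceType) (A : set I) (J : Type) (r : seq J)
    (h : J -> I -> R) : (forall j, exists c, psum_le p A (h j) c) ->
  exists c, psum_le p A (fun i => \sum_(j <- r) h j i) c.
Proof.
move=> hc; elim: r => [|j r [d IH]].
  exists 0 => q _ _; rewrite big1// => i _.
  by rewrite big_nil normr0 powR0 ?gt_eqF.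
have [c hj] := hc j; exists (2 `^ p * (c + d)).
by apply: (psum_le_eq p1 _ (psum_le_crudeD p1 hj IH)) => i _; rewrite big_cons.
Qed.

Section Amenable.
Variables (S : seq G) (C : R) (xi : nat -> G -> R).
Hypotheses (S_sym : symmetric_gen S) (S_gen : generating S) (C0 : 0 < C).
Hypotheses (xi_prob : forall n, fs_prob (xi n)) (xi_cvg : cvg_left_inv_mean xi).
Hypothesis xi_trc : forall s n, s \in S ->
  (trc S (rreg s (Defs.check (xi n))) (Defs.check (xi n)) <= C%:E)%E.

Lemma grad_lavg_cvg0 f B (i : G * G) e : (forall x, `|f x| <= B) ->
  cay_edges S i -> 0 < e ->
  exists N, forall n, (N <= n)%N ->
    `|grad (lavg (Defs.check (xi n)) f) i| < e.
Proof.
move=> fB [s sS]; case: i => x y /= <- e0.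
have B0 : 0 <= B := le_trans (normr_ge0 _) (fB 1%g).
(* Dividing by [B + 1] covers [B = 0] and leaves a strict inequality. *)
have d0 : 0 < e / (B + 1) by rewrite divr_gt0// ltr_wpDl.
have /(_ [set t | (t < (e / (B + 1))%:E)%E]%classic)[] := xi_cvg s.
  by apply: open_nbhs_nbhs; split; [exact: open_ereal_lt_ereal|rewrite /= lte_fin].
move=> N _ hN; exists N => n /hN /= /(lavg_bound x (xi_prob n) fB).
move/le_lt_trans; apply.
rewrite mulrA ltr_pdivrMr ?ltr_wpDl// mulrDr mulr1 mulrC.
by rewrite ltrDl.
Qed.

(** Vanishing is proved in this form: [f - h] is in l^p and approximates [f] up to a constant, as
    [grad h] is small. Here [h] is a Banach-Saks average of the functions [lavg (eta n) f]. *)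
Lemma approx_bounded f B D e : (forall x, `|f x| <= B) ->
  psum_le p (cay_edges S) (grad f) D -> 0 < e ->
  exists h c, psum_le p setT (fun x => f x - h x) c /\
    psum_le p (cay_edges S) (grad h) e.
Proof.
move=> fB fD e0.
pose eta n := Defs.check (xi n).
have eta_prob n : fs_prob (eta n) by exact: fs_prob_check.
have u_bd n : psum_le p (cay_edges S) (grad (lavg (eta n) f))
    ((size S)%:R * ((C + 2) `^ p * D)).
  apply: psum_le_grad => s sS;
  apply: (psum_le_lgrad_lavg p1 S_sym S_gen fD (eta_prob n) C0); exact: xi_trc.
have [ns ns0 hns] := banach_saks p1 u_bd
  (fun i e => grad_lavg_cvg0 fB) e0.
have k0 : (size ns)%:R != 0 :> R by rewrite pnatr_eq0 -lt0n.
exists (fun x => (size ns)%:R^-1 * \sum_(n <- ns) lavg (eta n) f x).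
have [c hc] := ex_psum_le_sum ns
  (fun n => psum_le_lavg_sub p1 S_sym S_gen fD (eta_prob n)).
eexists; split; last first.
  apply: (psum_le_eq p1 _ hns) => i _.
  by rewrite /grad -mulrBr -sumrB.
apply: (psum_le_eq p1 _ (psum_leZ (- (size ns)%:R^-1) hc)) => x _.
rewrite sumrB big_const_seq count_predT iter_addr_0 -[f x *+ _]mulr_natr.
by field.
Qed.

Lemma approx_truncated f D e : psum_le p (cay_edges S) (grad f) D -> 0 < e ->
  exists k, 0 <= k /\
    psum_le p (cay_edges S) (grad (fun x => f x - clamp k (f x))) e.
Proof.
move=> fD e0; have [F FS f_tail] := psum_le_tail fD e0.
(* [k] is at least [|f|] at both ends of every edge of [F], where truncation then changes nothing;
   off [F] the remainder is dominated by the tail of [grad f]. *)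
pose k := \sum_(e <- F) (`|f e.1| + `|f e.2|).
have k0 : 0 <= k by apply: sumr_ge0 => i _; rewrite addr_ge0.
exists k; split => // r r_uniq rS; rewrite (bigID (mem F))/= big1 => [|i iF].
  rewrite add0r -big_filter.
  apply: (@psum_le_dom _ _ _ _ p1 _ _ _ _ f_tail).
  - by move=> i _; exact: clamp_rest_lip.
  - by rewrite filter_uniq.
  - by move=> i; rewrite mem_filter => /andP[iF /rS].
have : `|f i.1| + `|f i.2| <= k.
  rewrite /k (big_rem i)//= lerDl; apply: sumr_ge0 => j _.
  by rewrite addr_ge0.
have := normr_ge0 (f i.1); have := normr_ge0 (f i.2) => n1 n2 nk.
by rewrite /grad !clamp_id ?subrr ?normr0 ?powR0 ?gt_eqF//; lra.
Qed.

Lemma approx_amenable f D e : psum_le p (cay_edges S) (grad f) D -> 0 < e ->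
  exists h c, psum_le p setT (fun x => f x - h x) c /\
    psum_le p (cay_edges S) (grad h) e.
Proof.
move=> fD e0; have two_p : 0 < 2 `^ p :> R by rewrite powR_gt0.
(* Two errors [e'], added at the price of a factor [2 ^ p], give exactly [e]. *)
pose e' := e / (2 * 2 `^ p).
have e'0 : 0 < e' by rewrite divr_gt0 ?mulr_gt0.
have [k [k0 hk]] := approx_truncated fD e'0.
have gD : psum_le p (cay_edges S) (grad (fun x => clamp k (f x))) D.
  by apply: (psum_le_dom p1 _ fD) => i _; exact: clamp_lip.
have [h [c [hc he]]] := approx_bounded (fun x => clamp_bounded (f x) k0) gD e'0.
(* The part of [f] cut off by truncation has small gradient, so it goes into [h]. *)
exists (fun x => h x + (f x - clamp k (f x))), c; split.
  by apply: (psum_le_eq p1 _ hc) => x _; ring.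
have -> : e = 2 `^ p * (e' + e') by rewrite /e'; field; rewrite gt_eqF.
by apply: (psum_le_eq p1 _ (psum_le_crudeD p1 he hk)) => i _; rewrite /grad; ring.
Qed.

End Amenable.

(** The generators [S0] given by transport amenability may differ from [S]: the gradient bound is
    carried to [S0], the small gradient back to [S]. *)
Lemma approx_real S f D e : transport_amenable R G ->
  symmetric_gen S -> generating S ->
  psum_le p (cay_edges S) (grad f) D -> 0 < e ->
  exists h c, psum_le p setT (fun x => f x - h x) c /\
    psum_le p (cay_edges S) (grad h) e.
Proof.
move=> [S0 [C [xi [S0_sym S0_gen C0 [xi_prob xi_cvg] xi_trc]]]] S_sym S_gen fD e0.
have [C1 _ to_S0] := psum_le_grad_change p1 S0 S_sym S_gen.
have [C2 C20 to_S] := psum_le_grad_change p1 S S0_sym S0_gen.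
have e'0 : 0 < e / C2 by rewrite divr_gt0.
have xi_trc' s n sS := xi_trc s n sS.
have [h [c [hc he]]] := approx_amenable S0_sym S0_gen C0 xi_prob xi_cvg
  xi_trc' (to_S0 _ _ fD) e'0.
exists h, c; split => //.
have -> : e = C2 * (e / C2) by field; rewrite gt_eqF.
exact: to_S.
Qed.

(** Real and imaginary parts are approximated separately: each is at most the modulus, which is at
    most the sum of their absolute values. *)
Lemma approx_complex S (f : G -> R[i]) D e : transport_amenable R G ->
  symmetric_gen S -> generating S ->
  psum_le p (cay_edges S) (fun i => Normc.normc (grad f i)) D -> 0 < e ->
  exists (h : G -> R[i]) c, psum_le p setT (fun x => Normc.normc (f x - h x)) c /\
    psum_le p (cay_edges S) (fun i => Normc.normc (grad h i)) e.
Proof.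
move=> amen S_sym S_gen fD e0.
have normc_Re (z : R[i]) : `|complex.Re z| <= `|Normc.normc z|.
  case: z => a b /=; rewrite [leRHS]ger0_norm ?sqrtr_ge0//.
  by rewrite -sqrtr_sqr ler_sqrt ?addr_ge0 ?sqr_ge0// lerDl sqr_ge0.
have normc_Im (z : R[i]) : `|complex.Im z| <= `|Normc.normc z|.
  case: z => a b /=; rewrite [leRHS]ger0_norm ?sqrtr_ge0//.
  by rewrite -sqrtr_sqr ler_sqrt ?addr_ge0 ?sqr_ge0// lerDr sqr_ge0.
have normc_le (z : R[i]) :
    `|Normc.normc z| <= `| `|complex.Re z| + `|complex.Im z| |.
  case: z => a b /=; rewrite ger0_norm ?sqrtr_ge0// ger0_norm ?addr_ge0//.
  rewrite -[leRHS]ger0_norm ?addr_ge0// -sqrtr_sqr ler_wsqrtr//.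
  rewrite sqrrD !real_normK ?num_real// addrAC lerDl.
  by rewrite mulrn_wge0// mulr_ge0.
have psum_norm (I : choiceType) (A : set I) (g : I -> R) c :
    psum_le p A g c -> psum_le p A (fun i => `|g i|) c.
  by apply: (psum_le_dom p1) => i _; rewrite normr_id.
have two_p : 0 < 2 `^ p :> R by rewrite powR_gt0.
pose e' := e / (2 * 2 `^ p).
have e'0 : 0 < e' by rewrite divr_gt0 ?mulr_gt0.
have uD : psum_le p (cay_edges S) (grad (fun x => complex.Re (f x))) D.
  apply: (psum_le_dom p1 _ fD) => i _; apply: le_trans (normc_Re _).
  by rewrite /grad; case: (f i.1) => ? ?; case: (f i.2).
have vD : psum_le p (cay_edges S) (grad (fun x => complex.Im (f x))) D.
  apply: (psum_le_dom p1 _ fD) => i _; apply: le_trans (normc_Im _).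
  by rewrite /grad; case: (f i.1) => ? ?; case: (f i.2).
have [hu [cu [hcu heu]]] := approx_real amen S_sym S_gen uD e'0.
have [hv [cv [hcv hev]]] := approx_real amen S_sym S_gen vD e'0.
exists (fun x => Complex (hu x) (hv x)), (2 `^ p * (cu + cv)); split.
  apply: (psum_le_dom p1 _
    (psum_le_crudeD p1 (psum_norm _ _ _ _ hcu) (psum_norm _ _ _ _ hcv))) => x _.
  by apply: le_trans (normc_le _) _; case: (f x).
have -> : e = 2 `^ p * (e' + e') by rewrite /e'; field; rewrite gt_eqF.
apply: (psum_le_dom p1 _
  (psum_le_crudeD p1 (psum_norm _ _ _ _ heu) (psum_norm _ _ _ _ hev))) => i _.
exact: normc_le.
Qed.

(** Abstract in [K] and [nrm] to serve both the real absolute value and the complex modulus. *)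
Lemma vanishes_of_approx (K : zmodType) (nrm : K -> R) S :
  nrm 0 = 0 -> (forall z, 0 <= nrm z) ->
  (forall (f : G -> K) D e,
     psum_le p (cay_edges S) (fun i => nrm (grad f i)) D -> 0 < e ->
     exists (h : G -> K) c, psum_le p setT (fun x => nrm (f x - h x)) c /\
       psum_le p (cay_edges S) (fun i => nrm (grad h i)) e) ->
  reduced_lpH1_vanishes nrm S p.
Proof.
move=> nrm0 nrm_ge0 approx f f_dir eps eps0.
have psumP (I : choiceType) (A : set I) (g : I -> K) c :
    (\esum_(i in A) ((nrm (g i)) `^ p)%:E <= c%:E)%E <->
    psum_le p A (fun i => nrm (g i)) c.
  rewrite esum_le_seqP => [|i]; last exact: powR_ge0.
  have nE r : \sum_(i <- r) `|nrm (g i)| `^ p = \sum_(i <- r) nrm (g i) `^ p.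
    by apply: eq_bigr => i _; rewrite ger0_norm.
  by split=> hc r r_uniq rA; move: (hc r r_uniq rA); rewrite nE.
have fD : psum_le p (cay_edges S) (fun i => nrm (grad f i))
    (fine (grad_pnorm_p nrm S p f)).
  apply/psumP; rewrite fineK// ge0_fin_numE//.
  by apply: esum_ge0 => i _; rewrite lee_fin powR_ge0.
have e0 : 0 < eps `^ p / 2 by rewrite divr_gt0 ?powR_gt0.
have [h [c [/psumP hc /psumP he]]] := approx f _ _ fD e0.
(* With the constant [h 1] the error is [h - h 1], which vanishes at the identity, so only the
   gradient term of the Dirichlet norm remains. *)
exists (fun x => f x - h x), (h 1%g); split.
  by apply: le_lt_trans hc _; exact: ltry.
have hE : (fun x => f x - (f x - h x + h 1%g)) = (fun x => h x - h 1%g).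
  by apply/funext => x; rewrite opprD opprB addrA subrKC.
rewrite /Dnorm_p hE subrK subrr nrm0 powR0 ?gt_eqF// adde0.
apply: (@le_lt_trans _ _ (eps `^ p / 2)%:E); last first.
  by rewrite lte_fin ltr_pdivrMr// ltr_pMr ?powR_gt0// ltr1n.
apply: le_trans he; apply: le_esum => i _.
by rewrite /grad opprB addrA subrK.
Qed.

End Approximation.

Theorem theorem1p3 (R : realType) (G : groupType) :
  transport_amenable R G ->
  forall p : R, 1 < p ->
  forall S : seq G, symmetric_gen S -> generating S ->
    reduced_lpH1_vanishes (fun x : R => `|x|) S p /\
    reduced_lpH1_vanishes (@Normc.normc R) S p.
Proof.
move=> amen p p1 S S_sym S_gen; split; apply: vanishes_of_approx => //.
- exact: normr0.
- move=> f D e fD e0.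
  have fD' : psum_le p (cay_edges S) (grad f) D.
    by apply: (psum_le_dom p1 _ fD) => i _; rewrite normr_id.
  have [h [c [hc he]]] := approx_real p1 amen S_sym S_gen fD' e0.
  exists h, c; split.
    by apply: (psum_le_dom p1 _ hc) => i _; rewrite normr_id.
  by apply: (psum_le_dom p1 _ he) => i _; rewrite normr_id.
- exact: Normc.normc0.
- by case=> a b; exact: sqrtr_ge0.
- by move=> f D e; exact: approx_complex.
Qed.
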